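(* It is decidable in polynomial time whether a given guessing history $\mathcal{H}=(x^i,s^i)_{i=1}^t$ (with $x^i\in\{0,1\}^n$, $s^i\in[0..n]$) is feasible. Furthermore, the number of pairs $(z,\pi)\in\{0,1\}^n\times S_n$ consistent with $\mathcal{H}$ can be computed efficiently (in polynomial time).
   Context: $[n]=\{1,\dots,n\}$, $[0..n]=\{0,1,\dots,n\}$, and $S_n$ is the set of permutations of $[n]$. For $z\in\{0,1\}^n$ and $\pi\in S_n$ define $f_{z,\pi}:\{0,1\}^n\to[0..n]$ by $f_{z,\pi}(x)=\max\{i\in[0..n]\mid \forall j\le i:\ z_{\pi(j)}=x_{\pi(j)}\}$. A guessing history is a finite sequence $\mathcal{H}=(x^i,s^i)_{i=1}^t$ of queries $x^i\in\{0,1\}^n$ and scores $s^i\in[0..n]$. A secret $(z,\pi)\in\{0,1\}^n\times S_n$ is consistent with $\mathcal{H}$ if $f_{z,\pi}(x^i)=s^i$ for all $i\in[t]$. $\mathcal{H}$ is feasible if there exists a secret consistent with it. Polynomial time means polynomial in the size of the input history, i.e. in $n$ and $t$. *)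

(* Defs.v *)
From HB Require Import structures.
From mathcomp Require Import all_boot all_fingroup all_algebra.

Set Implicit Arguments.
Unset Strict Implicit.
Unset Printing Implicit Defensive.

(* Positions are 0-based: position j of the mathematics is the ordinal j - 1. *)

Definition score n (z : n.-tuple bool) (pi : 'S_n) (x : n.-tuple bool) : nat :=
  \max_(i < n.+1 |
      [forall j : 'I_n, (j < i) ==> (tnth z (pi j) == tnth x (pi j))]) i.

Definition guess n : Type := (n.-tuple bool * 'I_n.+1)%type.

Definition history n := seq (guess n).

Definition secret n : finType := (n.-tuple bool * 'S_n)%type.

Definition consistent n (H : history n) (zp : secret n) : bool :=
  all (fun g : guess n => score zp.1 zp.2 g.1 == g.2) H.

Definition feasible n (H : history n) : bool :=
  [exists zp : secret n, consistent H zp].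

(* The word 1^n 0 x^1 1^(s^1) 0 ... x^t 1^(s^t) 0.  It is uniquely decodable,  *)
(* since every x^i has length n, and has length at most (n + 1) + t (2 n + 1),  *)
(* as every s^i is at most n.                                                  *)
Definition encode n (H : history n) : seq bool :=
  rcons (nseq n true) false ++
  flatten [seq val g.1 ++ rcons (nseq g.2 true) false | g : guess n <- H].

(* Binary numeral without superfluous zeros, least significant bit first;      *)
(* binary 0 is the empty word.                                                 *)
Definition binary (m : nat) : seq bool :=
  mkseq (fun i => odd (m %/ 2 ^ i)) (up_log 2 m.+1).

(* Deterministic multitape Turing machines over the tape alphabet 0, 1, blank, *)
(* represented by Some false, Some true and None.                              *)

Inductive move := MoveLeft | MoveStay | MoveRight.

Record machine := Machine {
  state : finType;
  nwork : nat;
  start : state;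
  final : {set state};
  delta : state -> {ffun 'I_nwork.+1 -> option bool} ->
          state * {ffun 'I_nwork.+1 -> option bool * move}
}.

(* A two-way infinite tape: the cells left of the head, nearest first, and the *)
(* cells from the scanned one rightwards; all cells not listed are blank.      *)
Definition tape := (seq (option bool) * seq (option bool))%type.

Definition scan (t : tape) : option bool := head None t.2.

Definition act (a : option bool * move) (t : tape) : tape :=
  let r := a.1 :: behead t.2 in
  match a.2 with
  | MoveLeft => (behead t.1, head None t.1 :: r)
  | MoveStay => (t.1, r)
  | MoveRight => (a.1 :: t.1, behead r)
  end.

Definition config (M : machine) :=
  (state M * {ffun 'I_(nwork M).+1 -> tape})%type.

Definition halted (M : machine) (c : config M) : bool := c.1 \in final M.

(* Halted configurations are fixed points, so that "after T steps" below reads *)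
(* "within T steps".                                                           *)
Definition step (M : machine) (c : config M) : config M :=
  if halted c then c else
  let qa := delta c.1 [ffun i => scan (c.2 i)] in
  (qa.1, [ffun i => act (qa.2 i) (c.2 i)]).

(* Tape 0 carries the input, with the head on its first letter, and likewise   *)
(* the output once the machine has halted.                                     *)
Definition init (M : machine) (w : seq bool) : config M :=
  (start M, [ffun i => ([::], if i == ord0 then map Some w else [::])]).

Fixpoint word_before_blank (r : seq (option bool)) : seq bool :=
  if r is Some b :: r' then b :: word_before_blank r' else [::].

Definition output (M : machine) (c : config M) : seq bool :=
  word_before_blank (c.2 ord0).2.

Definition computes_within (M : machine) (w : seq bool) (T : nat)
    (v : seq bool) : Prop :=
  let c := iter T (@step M) (init M w) in halted c /\ output c = v.

(* A single machine and a single polynomial serve all n and all histories.     *)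
Definition polytime (F : forall n, history n -> seq bool) : Prop :=
  exists (M : machine) (p : {poly nat}), forall n (H : history n),
    computes_within M (encode H) p.[(n + size H)%N]%R (F n H).

(* Main.v *)
Require Import Defs.
From HB Require Import structures.
From mathcomp Require Import all_boot all_fingroup all_algebra.
From mathcomp Require Import zify.

Set Implicit Arguments.
Unset Strict Implicit.
Unset Printing Implicit Defensive.

(* A secret (z, pi) is consistent iff, for every j, the pair (pi j, z (pi j)) *)
(* is allowed at j: a query x of score s requires bit x there if s > j, the *)
(* opposite bit if s = j, and nothing if s < j.  A position carrying an allowed *)
(* bit at an earlier index has an allowed bit at j in a number of ways that *)
(* depends on H and j only: repeating the earlier bit is possible iff no query *)
(* scores j, flipping it iff no query scores more than j.  So any choice for *)
(* the indices below j extends in exactly *)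
(*   #|allowed pairs at j| - j * ([no s = j] + [no s > j]) *)
(* ways, and the number of consistent secrets is the product of these numbers. *)
(* A Turing machine, obtained by compiling a structured program over tapes, *)
(* computes this product in binary: it counts allowed pairs in unary and *)
(* multiplies by repeated addition.  The two indicators are the answers for the *)
(* bits 0 and 1 at a dummy position where every query has bit 0; the letter *)
(* preceding each query in the encoding serves as that position. *)

(** * Structured programs over tapes *)

(** The maximum in the definition of the score turns into a conjunction of conditions on single
    positions ([score_compatible]), so a secret is consistent iff each tested position, paired with
    its bit, passes a test that depends only on its index ([consistentE]). When these pairs are
    chosen index by index, the only interaction is that positions must not repeat. A position
    already used carries a bit allowed at an earlier index, hence a bit that agrees with every query
    of larger score. This makes the number of excluded pairs independent of the earlier choices
    ([card_allowed_bits], [card_partial_secret_rcons]). The count is therefore the product of the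
    numbers [choices H j] ([card_consistent]), and feasibility means that the product is nonzero.

    On the machine side, [runs] is a semantics with step bounds for structured programs, and
    [runs_sound] transfers it to Turing machines. Each factor is at most 2n and can be handled in
    unary, while the product, of at most 2n^2 + 1 bits ([size_product]), is kept in binary. The
    resulting time bound is built from n and t by sums and products, hence is a polynomial
    ([polynomial_total_time]). *)

Notation symbol := (option bool).

Definition blank : tape := ([::], [::]).

(* Keeps lists of cells free of trailing blanks, so that erasing a tape and *)
(* moving over blanks give back syntactically equal tapes. *)
Definition scons (a : symbol) (r : seq symbol) : seq symbol :=
  if a is Some _ then a :: r else if r is [::] then [::] else a :: r.

Definition norm_act (a : symbol * move) (t : tape) : tape :=
  let r := scons a.1 (behead t.2) in
  match a.2 with
  | MoveLeft => (behead t.1, scons (head None t.1) r)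
  | MoveStay => (t.1, r)
  | MoveRight => (scons a.1 t.1, behead t.2)
  end.

Definition same_tape (t u : tape) : Prop :=
  (forall i, nth None t.1 i = nth None u.1 i) /\
  (forall i, nth None t.2 i = nth None u.2 i).

Lemma nth_scons a r i : nth None (scons a r) i = nth None (a :: r) i.
Proof. by case: a => [b|]; case: r => [|c r]; case: i => [|[|i]]. Qed.

Lemma same_tape_scan t u : same_tape t u -> scan t = scan u.
Proof. by case=> _ tu; rewrite /scan -!nth0 tu. Qed.

Lemma same_tape_act a t u :
  same_tape t u -> same_tape (Defs.act a t) (norm_act a u).
Proof.
case=> tu1 tu2; case: a => a [] /=; split=> [] [|i] //=;
  rewrite ?nth_scons /= ?nth_scons ?nth_behead //= -?nth0 ?tu1 //.
by case: i => [|i] /=; rewrite ?nth_scons /= ?nth_behead ?tu2.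
Qed.

(** The machine acts on every tape at each step, so a tape left alone has its scanned symbol
    rewritten; at most this lists one more blank. *)
Lemma same_tape_idle t u :
  same_tape t u -> same_tape (Defs.act (scan t, MoveStay) t) u.
Proof.
case=> tu1 tu2; split=> //= -[|i] /=; first by rewrite -tu2 nth0.
by rewrite nth_behead tu2.
Qed.

Definition store := seq tape.

Definition reads (s : store) : seq symbol := map scan s.

Inductive cmd :=
| Do of (seq symbol -> nat -> option (symbol * move))
| Seq of cmd & cmd
| If of (seq symbol -> bool) & cmd & cmd
| While of (seq symbol -> bool) & cmd.

Definition apply_do (F : seq symbol -> nat -> option (symbol * move))
    (s : store) : store :=
  mkseq (fun i => if F (reads s) i is Some a then norm_act a (nth blank s i)
                  else nth blank s i) (size s).

(** The number is an upper bound on the machine steps, which [runs_leq] may weaken. Every test of a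
    condition costs one step. *)
Inductive runs : cmd -> store -> store -> nat -> Prop :=
| runs_do F s : runs (Do F) s (apply_do F s) 1
| runs_seq c1 c2 s1 s2 s3 T1 T2 :
    runs c1 s1 s2 T1 -> runs c2 s2 s3 T2 -> runs (Seq c1 c2) s1 s3 (T1 + T2)
| runs_ifT (f : _ -> bool) c1 c2 s s' T :
    f (reads s) -> runs c1 s s' T -> runs (If f c1 c2) s s' T.+1
| runs_ifF (f : _ -> bool) c1 c2 s s' T :
    ~~ f (reads s) -> runs c2 s s' T -> runs (If f c1 c2) s s' T.+1
| runs_whileF (f : _ -> bool) c s : ~~ f (reads s) -> runs (While f c) s s 1
| runs_whileT (f : _ -> bool) c s1 s2 s3 T1 T2 :
    f (reads s1) -> runs c s1 s2 T1 -> runs (While f c) s2 s3 T2 ->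
    runs (While f c) s1 s3 (T1 + T2).+1
| runs_leq c s s' T T' : runs c s s' T -> T <= T' -> runs c s s' T'.

(** Program points; [None] is the test of a conditional or of a loop. *)
Fixpoint label (c : cmd) : finType :=
  match c with
  | Do _ => unit : finType
  | Seq a b => (label a + label b)%type : finType
  | If _ a b => option (label a + label b)%type : finType
  | While _ a => option (label a) : finType
  end.

Fixpoint entry (c : cmd) : label c :=
  match c return label c with
  | Do _ => tt
  | Seq a b => inl (entry a)
  | If _ a b => None
  | While _ a => None
  end.

(* [None] as the next label means that control leaves the command. *)
Definition fragment (L : Type) :=
  L -> seq symbol -> option L * (nat -> option (symbol * move)).

Definition idle (i : nat) : option (symbol * move) := None.

Fixpoint trans (c : cmd) : fragment (label c) :=
  match c return fragment (label c) with
  | Do F => fun _ r => (None, F r)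
  | Seq a b => fun l r =>
    match l with
    | inl l => let q := trans l r in
      (Some (if q.1 is Some l' then inl l' else inr (entry b)), q.2)
    | inr l => let q := trans l r in (omap inr q.1, q.2)
    end
  | If f a b => fun l r =>
    match l with
    | None =>
      (Some (Some (if f r then inl (entry a) else inr (entry b))), idle)
    | Some (inl l) => let q := trans l r in (omap (Some \o inl) q.1, q.2)
    | Some (inr l) => let q := trans l r in (omap (Some \o inr) q.1, q.2)
    end
  | While f a => fun l r =>
    match l with
    | None => (if f r then Some (Some (entry a)) else None, idle)
    | Some l => let q := trans l r in (Some q.1, q.2)
    end
  end.

(** * Compilation of programs to Turing machines *)

Section Compile.
Variables (k : nat) (c0 : cmd).

Definition acts (r : {ffun 'I_k.+1 -> symbol})
    (F : nat -> option (symbol * move)) : {ffun 'I_k.+1 -> symbol * move} :=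
  [ffun i : 'I_k.+1 => if F i is Some a then a else (r i, MoveStay)].

Definition compiled : machine :=
  @Machine (option (label c0)) k (Some (entry c0)) [set None]
    (fun q r =>
       if q is Some l then
         let q' := trans l (codom r) in (q'.1, acts r q'.2)
       else (None, acts r idle)).

Definition matches (tp : {ffun 'I_k.+1 -> tape}) (s : store) : Prop :=
  size s = k.+1 /\ forall i : 'I_k.+1, same_tape (tp i) (nth blank s i).

Definition after (tp : {ffun 'I_k.+1 -> tape})
    (F : nat -> option (symbol * move)) : {ffun 'I_k.+1 -> tape} :=
  [ffun i => Defs.act (acts [ffun i => scan (tp i)] F i) (tp i)].

Lemma step_compiled l (tp : {ffun 'I_k.+1 -> tape}) :
  let q := trans l (codom [ffun i => scan (tp i)]) in
  @step compiled (Some l, tp) = (q.1, after tp q.2).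
Proof. by rewrite /step /halted /= inE. Qed.

Lemma matches_reads (tp : {ffun 'I_k.+1 -> tape}) s :
  matches tp s -> codom [ffun i => scan (tp i)] = reads s.
Proof.
case=> ss tps; apply: (@eq_from_nth _ None).
  by rewrite size_codom card_ord size_map ss.
move=> i; rewrite size_codom card_ord => lt_i.
rewrite (nth_map blank) ?ss // -(same_tape_scan (tps (Ordinal lt_i))).
rewrite codomE (nth_map (Ordinal lt_i)) ?size_enum_ord // ffunE.
by congr (scan (tp _)); apply: val_inj; rewrite /= nth_enum_ord.
Qed.

Lemma matches_idle tp s : matches tp s -> matches (after tp idle) s.
Proof.
by case=> ss tps; split=> // i; rewrite !ffunE /=; apply: same_tape_idle.
Qed.

Lemma matches_do tp s F :
  matches tp s -> matches (after tp (F (reads s))) (apply_do F s).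
Proof.
case=> ss tps; split=> [|i]; first by rewrite size_mkseq.
rewrite nth_mkseq ?ss // !ffunE; case: (F _ _) => [a|].
  exact: same_tape_act.
exact: same_tape_idle.
Qed.

(* [c] sits inside [c0] via [e], and control continues at [q] after it. *)
Definition embeds c (e : label c -> label c0) (q : option (label c0)) : Prop :=
  forall l r, trans (e l) r =
    (if (trans l r).1 is Some l' then Some (e l') else q, (trans l r).2).

(** Induction on the derivation. The embedding [e] and the exit [q] are general so that a subprogram
    can be followed in place: the first part of a sequence exits to the entry of the second, and a
    loop body exits to the test of its loop. *)
Lemma runs_sound c s s' T : runs c s s' T -> forall e q, embeds e q ->
  forall tp, matches tp s -> exists2 m, m <= T & exists2 tp', matches tp' s' &
    iter m (@step compiled) (Some (e (entry c)), tp) = (q, tp').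
Proof.
elim=> {c s s' T}.
- move=> F s e q eq tp m_tp; exists 1 => //=.
  exists (after tp (F (reads s))); first exact: matches_do.
  by rewrite step_compiled (matches_reads m_tp) eq.
- move=> c1 c2 s1 s2 s3 T1 T2 _ IH1 _ IH2 e q eq tp m_tp.
  have [|m1 le1 [tp1 m_tp1 E1]] :=
      IH1 (e \o inl) (Some (e (inr (entry c2)))) _ _ m_tp.
    by move=> l r; rewrite /= eq /=; case: (trans l r) => -[].
  have [|m2 le2 [tp2 m_tp2 E2]] := IH2 (e \o inr) q _ _ m_tp1.
    by move=> l r; rewrite /= eq /=; case: (trans l r) => -[].
  exists (m2 + m1); first by rewrite addnC leq_add.
  by exists tp2; rewrite // iterD E1.
- move=> f c1 c2 s s' T fs _ IH e q eq tp m_tp.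
  have [|m le [tp1 m_tp1 E1]] := IH (e \o Some \o inl) q _ _ (matches_idle m_tp).
    by move=> l r; rewrite /= eq /=; case: (trans l r) => -[].
  exists m.+1 => //; exists tp1 => //.
  by rewrite iterSr step_compiled (matches_reads m_tp) eq /= fs.
- move=> f c1 c2 s s' T fs _ IH e q eq tp m_tp.
  have [|m le [tp1 m_tp1 E1]] := IH (e \o Some \o inr) q _ _ (matches_idle m_tp).
    by move=> l r; rewrite /= eq /=; case: (trans l r) => -[].
  exists m.+1 => //; exists tp1 => //.
  by rewrite iterSr step_compiled (matches_reads m_tp) eq /= (negPf fs).
- move=> f c s fs e q eq tp m_tp; exists 1 => //.
  exists (after tp idle); first exact: matches_idle.
  by rewrite /= step_compiled (matches_reads m_tp) eq /= (negPf fs).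
- move=> f c s1 s2 s3 T1 T2 fs _ IH1 _ IH2 e q eq tp m_tp.
  have [|m1 le1 [tp1 m_tp1 E1]] :=
      IH1 (e \o Some) (Some (e None)) _ _ (matches_idle m_tp).
    by move=> l r; rewrite /= eq /=; case: (trans l r) => -[].
  have [m2 le2 [tp2 m_tp2 E2]] := IH2 e q eq _ m_tp1.
  exists (m2 + m1).+1; first by rewrite ltnS addnC leq_add.
  exists tp2 => //.
  by rewrite iterSr step_compiled (matches_reads m_tp) eq /= fs iterD E1.
- move=> c s s' T T' _ IH le e q eq tp m_tp.
  have [m le1 E] := IH e q eq tp m_tp.
  by exists m => //; apply: leq_trans le.
Qed.

End Compile.

Lemma runs_halts k c w s T :
  runs c ((([::], map Some w) : tape) :: nseq k blank) s T ->
  computes_within (compiled k c) w T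
    (word_before_blank (nth blank s 0).2).
Proof.
move=> r.
have emb : @embeds c c id None by move=> l r'; case: (trans l r') => -[].
have [|m le_m [tp [ss tps] E]] := @runs_sound k c _ _ _ _ r id None emb
    [ffun i => ([::], if i == ord0 then map Some w else [::])].
  split=> [|i]; first by rewrite /= size_nseq.
  rewrite ffunE; case: i => -[|i] lt_i //=.
  by rewrite nth_nseq; case: ifP.
have halt : @halted (compiled k c) (None, tp).
  by rewrite /halted inE.
have fix_halt d : iter d (@step (compiled k c)) (None, tp) = (None, tp).
  by elim: d => //= d ->; rewrite /step halt.
have ET : iter T (@step (compiled k c)) (init (compiled k c) w) = (None, tp).
  by rewrite -(subnK le_m) iterD /init E.
split; rewrite ET // /output /=.
(* The output ends at the first blank, so trailing blanks do not affect it. *)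
have [_] := tps ord0; move: (tp ord0).2 (nth blank s 0).2 => u v.
elim: u v => [|[b|] u IHu] [|[b'|] v] // Euv; have := Euv 0 => //=.
by case=> <-; congr (_ :: _); apply: IHu => i; apply: (Euv i.+1).
Qed.

(** * Counting consistent secrets *)

(* Whether a query with bit [x] at a position and score [s] lets the secret *)
(* have the bit [b] there, this position being the [j]-th one tested. *)
Definition compatible (b : bool) (j : nat) (x : bool) (s : nat) : bool :=
  if s < j then true else if s == j then x != b else x == b.

Definition allowed n (H : history n) (j : nat) (q : 'I_n * bool) : bool :=
  all (fun g : guess n => compatible q.2 j (tnth g.1 q.1) g.2) H.

(* At a position whose bit [b] is allowed at an earlier index, the number of *)
(* bits allowed at [j]; the first summand stands for [b] itself. *)
Definition overlap n (H : history n) (j : nat) : nat :=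
  all (fun g : guess n => compatible false j false g.2) H +
  all (fun g : guess n => compatible true j false g.2) H.

(** The truncated subtraction is exact as soon as some choice for the indices below [j] exists;
    otherwise the product of the earlier factors is already 0. *)
Definition choices n (H : history n) (j : nat) : nat :=
  #|[pred q | allowed H j q]| - j * overlap H j.

(** The lengths up to which [z] and [x] agree along [pi] form an initial segment, so the maximum is
    [s] iff they agree below [s] but not below [s + 1], that is, differ at index [s]. For [s = n]
    there is no such index and the upper bound is automatic. *)
Lemma score_compatible n (z : n.-tuple bool) (pi : 'S_n) (x : n.-tuple bool)
    (s : 'I_n.+1) :
  (score z pi x == s) =
  [forall j : 'I_n, compatible (tnth z (pi j)) j (tnth x (pi j)) s].
Proof.
pose agree (i : nat) :=
  [forall j : 'I_n, (j < i) ==> (tnth z (pi j) == tnth x (pi j))].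
have agree_le i k : k <= i -> agree i -> agree k.
  move=> le_ki /forallP Pi; apply/forallP => j; apply/implyP => lt_jk.
  by move/implyP: (Pi j) => -> //; apply: leq_trans le_ki.
have geq_score (i : 'I_n.+1) : (i <= score z pi x) = agree i.
  apply/idP/idP => [|Pi]; last first.
    exact: (leq_bigmax_cond (F := fun i : 'I_n.+1 => i : nat)).
  apply/contraTT => nPi; rewrite -ltnNge.
  have [k Pk ->] : {k : 'I_n.+1 | agree k & score z pi x = k}.
    apply: eq_bigmax_cond; apply/card_gt0P; exists ord0.
    by apply/forallP.
  by rewrite ltnNge; apply: contra nPi => /agree_le; apply.
have score_n : score z pi x <= n.
  by apply/bigmax_leqP => i _; rewrite -ltnS.
rewrite eqn_leq [s <= _]geq_score andbC.
apply/andP/forallP => [[/forallP ag le_s] j | comp].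
  rewrite /compatible; case: ltngtP => // [lt_js | eq_sj].
    by have := ag j; rewrite lt_js eq_sym.
  apply/negP => /eqP zx; move: le_s; rewrite leqNgt => /negP; apply.
  have lt_s : s.+1 < n.+1 by rewrite ltnS eq_sj.
  rewrite (geq_score (Ordinal lt_s)); apply/forallP => i; apply/implyP.
  rewrite ltnS leq_eqVlt => /orP[/eqP eq_is | lt_is].
    suff -> : i = j by rewrite zx.
    by apply: val_inj; rewrite /= eq_is.
  by have := ag i; rewrite lt_is.
split.
  apply/forallP => j; apply/implyP => lt_js.
  by have := comp j; rewrite /compatible ltnNge ltnW //= gtn_eqF // eq_sym.
have [lt_sn|] := ltnP s n; last exact: leq_trans.
rewrite leqNgt; have lt_s : s.+1 < n.+1 by [].
rewrite (geq_score (Ordinal lt_s)); apply/negP => /forallP/(_ (Ordinal lt_sn)).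
have := comp (Ordinal lt_sn); rewrite /compatible ltnn /= eqxx ltnSn /= eq_sym.
by move=> /negPf->.
Qed.

Lemma consistentE n (H : history n) (zp : secret n) :
  consistent H zp =
  [forall j : 'I_n, allowed H j (zp.2 j, tnth zp.1 (zp.2 j))].
Proof.
apply/allP/forallP => [cons j | cons g gH].
  by apply/allP => g /cons; rewrite score_compatible => /forallP/(_ j).
by rewrite score_compatible; apply/forallP => j; apply: (allP (cons j)).
Qed.

Section Count.
Variables (n : nat) (H : history n).
Implicit Types (t : seq ('I_n * bool)) (q : 'I_n * bool).

(** Entry [i] of [t] stands for the pair [(pi i, z (pi i))], so [t] describes the initial part of a
    secret. *)
Definition partial_secret t : bool :=
  uniq (unzip1 t) &&
  all (fun iq => allowed H iq.1 iq.2) (zip (iota 0 (size t)) t).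

Lemma partial_secret_rcons t q :
  partial_secret (rcons t q) =
  [&& partial_secret t, q.1 \notin unzip1 t & allowed H (size t) q].
Proof.
rewrite /partial_secret size_rcons -addn1 iotaD add0n cats1.
rewrite zip_rcons ?size_iota // all_rcons /=.
rewrite /unzip1 map_rcons rcons_uniq.
by rewrite [RHS]andbC -!andbA; do ?bool_congr.
Qed.

Lemma partial_secretP t i : partial_secret t -> i \in unzip1 t ->
  exists b j, [&& allowed H j (i, b) & j < size t].
Proof.
elim/last_ind: t => // t q IH; rewrite partial_secret_rcons => /and3P[vt _ aq].
rewrite /unzip1 map_rcons mem_rcons inE size_rcons => /orP[/eqP->|/(IH vt)].
  by exists q.2, (size t); rewrite ltnSn -surjective_pairing aq.
by case=> b [j /andP[aj lt_j]]; exists b, j; rewrite aj ltnW.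
Qed.

(** A query scoring at least [k] scores more than [j], so its bit at [i] is [b]; queries of lower
    score impose nothing at [k]. Hence [c] is judged at [i] as [c (+) b] would be at a position
    where all queries have bit 0, and summing over [c] removes the dependence on [b]. *)
Lemma card_allowed_bits i b j k : allowed H j (i, b) -> j < k ->
  allowed H k (i, false) + allowed H k (i, true) = overlap H k.
Proof.
move=> aj lt_jk; rewrite /overlap.
have E c : allowed H k (i, c) =
    all (fun g : guess n => compatible (c (+) b) k false g.2) H.
  apply: eq_in_all => g /(allP aj) /=; rewrite /compatible.
  case: (ltngtP g.2 k) => // [lt_kg|->].
    have lt_jg := ltn_trans lt_jk lt_kg.
    by rewrite ltnNge ltnW //= gtn_eqF //= => /eqP->; case: (b) (c) => -[].
  by rewrite ltnNge ltnW //= gtn_eqF //= => /eqP->; case: (b) (c) => -[].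
by rewrite !E; case: (b); rewrite // addnC.
Qed.

(** Among the pairs allowed at index [size t], those on used positions must be discarded. There are
    [size t] such positions, and each accounts for [overlap H (size t)] pairs. *)
Lemma card_partial_secret_rcons t : partial_secret t ->
  #|[pred q | partial_secret (rcons t q)]| = choices H (size t).
Proof.
move=> vt; rewrite /choices.
rewrite -(cardID [pred q | q.1 \in unzip1 t] [pred q | allowed H (size t) q]).
have -> : #|[predI [pred q | allowed H (size t) q] & [pred q | q.1 \in unzip1 t]]|
    = size t * overlap H (size t).
  rewrite -sum1_card; under eq_bigl => q do rewrite !inE andbC.
  rewrite big_mkcondr /=.
  transitivity (\sum_(i | i \in unzip1 t) \sum_(b : bool) allowed H (size t) (i, b)).
    rewrite pair_big_dep /=; apply: eq_big => [[i b]|[i b] _] /=.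
      by rewrite andbT.
    by case: allowed.
  rewrite (eq_bigr (fun=> overlap H (size t))) => [|i it].
    rewrite sum_nat_const; congr (_ * _).
    have /andP[/card_uniqP -> _] := vt; exact: size_map.
  have [b [j /andP[aj lt_j]]] := partial_secretP vt it.
  by rewrite big_bool /= addnC; apply: card_allowed_bits aj lt_j.
rewrite addKn; apply: eq_card => q.
by rewrite !inE /= partial_secret_rcons vt.
Qed.

Definition tuple_snoc (T : Type) k (p : k.-tuple T * T) : k.+1.-tuple T :=
  [tuple of rcons p.1 p.2].

Lemma card_partial_secrets k :
  #|[pred t : k.-tuple ('I_n * bool) | partial_secret t]| =
  \prod_(j < k) choices H j.
Proof.
elim: k => [|k IHk].
  rewrite big_ord0 -[RHS](card_tuple 0 ('I_n * bool)%type).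
  by apply: eq_card => t; rewrite !inE tuple0.
rewrite big_ord_recr -IHk /= -sum1_card.
have snocK : bijective (@tuple_snoc ('I_n * bool) k).
  apply: inj_card_bij => [[t q] [t' q'] /(congr1 val)/rcons_inj[tt' ->]|].
    by congr (_, _); apply: val_inj.
  by rewrite card_prod !card_tuple expnSr.
rewrite (reindex _ (onW_bij _ snocK)) /=.
rewrite (eq_bigl (fun p : k.-tuple _ * _ => partial_secret p.1 &&
           partial_secret (rcons p.1 p.2))); last first.
  by move=> [t q]; rewrite inE /= partial_secret_rcons; case: (partial_secret t).
rewrite -(pair_big_dep (fun t : k.-tuple _ => partial_secret t)
  (fun (t : k.-tuple _) q => partial_secret (rcons t q)) (fun _ _ => 1)) /=.
rewrite (eq_bigr (fun=> choices H k)) ?sum_nat_const // => t vt.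
by rewrite sum1_card card_partial_secret_rcons // size_tuple.
Qed.

Definition secret_tuple (zp : secret n) : n.-tuple ('I_n * bool) :=
  [tuple (zp.2 j, tnth zp.1 (zp.2 j)) | j < n].

Lemma secret_tuple_inj : injective secret_tuple.
Proof.
move=> [z pi] [z' pi'] E.
have Ej j : (pi j, tnth z (pi j)) = (pi' j, tnth z' (pi' j)).
  by have := congr1 (fun t : n.-tuple _ => tnth t j) E; rewrite !tnth_mktuple.
have Epi : pi = pi' by apply/permP => j; case: (Ej j).
congr (_, _) => //; apply: eq_from_tnth => i.
by have [_] := Ej ((pi^-1)%g i); rewrite -Epi permKV.
Qed.

Lemma partial_secretE (t : n.-tuple ('I_n * bool)) :
  partial_secret t =
  uniq (unzip1 t) && [forall j : 'I_n, allowed H j (tnth t j)].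
Proof.
congr (_ && _).
have zipE (j : 'I_n) : (j : nat, tnth t j) \in zip (iota 0 (size t)) t.
  (* ['I_n] may be empty, so the default for [nth] is taken from the tuple. *)
  have q := tnth t j.
  apply/(nthP (0, q)); exists j.
    by rewrite size_zip size_iota minnn size_tuple.
  by rewrite nth_zip ?size_iota // nth_iota ?size_tuple // (tnth_nth q).
apply/allP/forallP => [al j|al [j q]]; first exact: (al _ (zipE j)).
case/(nthP (0, q)) => i; rewrite size_zip size_iota minnn size_tuple => lt_in.
rewrite nth_zip ?size_iota ?size_tuple // nth_iota // => -[<- <-].
by have := al (Ordinal lt_in); rewrite (tnth_nth q).
Qed.

(** In a partial secret of length n the positions are distinct, so they form a permutation, and the
    bits then determine [z]. Thus [secret_tuple] matches consistent secrets with partial secrets of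
    full length. *)
Theorem card_consistent :
  #|[set zp : secret n | consistent H zp]| = \prod_(j < n) choices H j.
Proof.
rewrite -card_partial_secrets -(card_imset _ secret_tuple_inj).
apply: eq_card => t; rewrite inE; apply/imsetP/idP => [[zp]|].
  rewrite inE consistentE partial_secretE => /forallP cons ->.
  apply/andP; split.
    rewrite /unzip1 -map_comp map_inj_uniq ?enum_uniq //.
    exact: perm_inj.
  by apply/forallP => j; rewrite tnth_mktuple.
rewrite partial_secretE => /andP[uniq_t /forallP al].
pose f (j : 'I_n) := (tnth t j).1.
have f_inj : injective f.
  move=> i j; rewrite /f => Eij; apply: val_inj => /=.
  apply/eqP; have q := tnth t i.
  rewrite -(nth_uniq q.1 _ _ uniq_t) ?size_map ?size_tuple //.
  by move: Eij; rewrite !(tnth_nth q) !(nth_map q) ?size_tuple // => ->.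
pose pi := perm f_inj.
pose zp : secret n := ([tuple (tnth t ((pi^-1)%g i)).2 | i < n], pi).
have Et : t = secret_tuple zp.
  apply: eq_from_tnth => j; rewrite tnth_mktuple /= tnth_mktuple permK permE.
  exact: surjective_pairing.
exists zp => //; rewrite inE consistentE; apply/forallP => j.
by have := al j; rewrite {1}Et tnth_mktuple.
Qed.
End Count.

(** * Binary addition *)

Fixpoint incr (r : seq bool) (c : bool) : seq bool :=
  if c then if r is y :: r' then ~~ y :: incr r' y else [:: true] else r.

Definition majority (x y z : bool) : bool := x && y || z && (x || y).

(** Ripple-carry addition. Missing digits of [r] count as 0, and after the end of [a] only the carry
    is propagated, exactly as [add_loop] does on tapes. *)
Fixpoint add_bits (a r : seq bool) (c : bool) : seq bool :=
  if a is x :: a' then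
    x (+) head false r (+) c ::
      add_bits a' (behead r) (majority x (head false r) c)
  else incr r c.

(** Replaces the digit-wise definition by a recursion, along which the carry arguments proceed by
    induction. *)
Lemma binary_rec m : 0 < m -> binary m = odd m :: binary m./2.
Proof.
move=> m_gt0; rewrite /binary.
have -> : up_log 2 m.+1 = (up_log 2 m./2.+1).+1.
  have [m1|m2] := posnP m./2.
    by rewrite (_ : m = 1) //; lia.
  case Ek: (up_log 2 m./2.+1) => [|k].
    by move/eqP: Ek; rewrite up_log_eq0; lia.
  have := up_log_bounds (isT : 1 < 2) (_ : 1 < m./2.+1).
  rewrite Ek /= ltnS => /(_ m2); rewrite expnS => /andP[lt_k ge_k].
  by apply: up_log_eq => //; rewrite !expnS; lia.
rewrite /mkseq /= (iotaDl 1 0) -map_comp expn0 divn1; congr (_ :: _).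
by apply: eq_map => i /=; rewrite expnS divnMA divn2.
Qed.

Lemma size_binary m k : m < 2 ^ k -> size (binary m) <= k.
Proof. by move=> lt_m; rewrite size_mkseq; apply: up_log_min. Qed.

Lemma binary_eq0 m : (binary m == [::]) = (m == 0).
Proof. by case: m => // m; rewrite binary_rec. Qed.

Lemma incr_binary r c : incr (binary r) c = binary (r + c).
Proof.
case: c; last by rewrite addn0; case: (binary r).
elim/ltn_ind: r => r IHr; have [->//|r_gt0] := posnP r.
rewrite addn1 (binary_rec r_gt0) (binary_rec (ltn0Sn r)) /=; congr (_ :: _).
rewrite uphalf_half; case: (odd r); last by case: (binary _).
by rewrite IHr ?addn1 ?add1n //; lia.
Qed.

Lemma add_bits_binary a r c :
  add_bits (binary a) (binary r) c = binary (a + r + c).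
Proof.
elim/ltn_ind: a r c => a IHa r c; have [->|a_gt0] := posnP a.
  by rewrite add0n -incr_binary; case: (binary r).
rewrite (binary_rec a_gt0) (@binary_rec (a + r + c)); last by lia.
have hd_r : head false (binary r) = odd r.
  by have [->|/binary_rec->] := posnP r.
have bh_r : behead (binary r) = binary r./2.
  by have [->|/binary_rec->] := posnP r.
rewrite /= hd_r bh_r IHa; last by lia.
congr (_ :: binary _); first by rewrite !oddD oddb.
by rewrite /majority; case: c; lia.
Qed.

(** * The program *)

Notation "c1 ;; c2" := (Seq c1 c2) (at level 61, right associativity).

Definition on (i : nat) (f : seq symbol -> symbol) (m : move) : cmd :=
  Do (fun r j => if j == i then Some (f r, m) else None).

Definition cell (r : seq symbol) (i : nat) : symbol := nth None r i.

Definition is_one (i : nat) (r : seq symbol) : bool := cell r i == Some true.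
Definition nonblank (i : nat) (r : seq symbol) : bool := cell r i != None.

Definition skip : cmd := Do (fun _ _ => None).
Definition shift (i : nat) (m : move) : cmd := on i (fun r => cell r i) m.
Definition put (i : nat) (a : symbol) (m : move) : cmd := on i (fun=> a) m.

(** The first shift is made untested because the head may be on the blank after the word, where the
    loop would stop at once. *)
Definition rewind (i : nat) : cmd :=
  shift i MoveLeft;; While (nonblank i) (shift i MoveLeft);; shift i MoveRight.

Definition copy_ones (i k : nat) : cmd :=
  While (is_one i) (put k (Some true) MoveRight;; shift i MoveRight).

Definition zipper (l r : seq bool) : tape := (map Some l, map Some r).
Definition ones (m : nat) : tape := zipper (nseq m true) [::].

(** The tape [zipper l r] after one move to the left; for empty [l] the head is on the blank before
    the word. *)
Definition left_of (l r : seq bool) : tape :=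
  if l is a :: l' then zipper l' (a :: r) else ([::], scons None (map Some r)).

Lemma runs_on i f m s : i < size s ->
  runs (on i f m) s
    (set_nth blank s i (norm_act (f (reads s), m) (nth blank s i))) 1.
Proof.
move=> lt_i; set s' := set_nth _ _ _ _.
suff -> : s' = apply_do (fun r j => if j == i then Some (f r, m) else None) s.
  exact: runs_do.
have ss' : size s' = size s by rewrite size_set_nth; apply/maxn_idPr.
apply: (@eq_from_nth _ blank) => [|j]; first by rewrite size_mkseq.
rewrite ss' => lt_j; rewrite nth_mkseq // nth_set_nth /=.
by case: eqP => [->|].
Qed.

Lemma runs_seq_leq T1 T2 T c1 c2 s1 s2 s3 :
  runs c1 s1 s2 T1 -> runs c2 s2 s3 T2 -> T1 + T2 <= T ->
  runs (c1;; c2) s1 s3 T.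
Proof. by move=> r1 r2; apply: runs_leq; apply: runs_seq r1 r2. Qed.

Lemma runs_while_leq T1 T2 T (f : _ -> bool) c s1 s2 s3 :
  f (reads s1) -> runs c s1 s2 T1 -> runs (While f c) s2 s3 T2 ->
  T1 + T2 < T -> runs (While f c) s1 s3 T.
Proof. by move=> fs r1 r2; apply: runs_leq; apply: runs_whileT r1 r2. Qed.

Lemma cell_reads s i : cell (reads s) i = scan (nth blank s i).
Proof.
have [lt_i|ge_i] := ltnP i (size s); first by rewrite /cell (nth_map blank).
by rewrite /cell !nth_default // size_map.
Qed.

Lemma norm_act_left l r :
  norm_act (head None (map Some r), MoveLeft) (zipper l r) = left_of l r.
Proof. by case: l => [|a l]; case: r. Qed.

Lemma set_nth_same s i (t u : tape) :
  set_nth blank (set_nth blank s i t) i u = set_nth blank s i u.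
Proof. by rewrite set_set_nth eqxx. Qed.

Lemma size_set_nth_lt s i (t : tape) :
  i < size s -> size (set_nth blank s i t) = size s.
Proof. by move=> lt_i; rewrite size_set_nth; apply/maxn_idPr. Qed.

Lemma set_nth_nth s i (t : tape) :
  i < size s -> nth blank s i = t -> set_nth blank s i t = s.
Proof.
move=> lt_i <-; apply: (@eq_from_nth _ blank); first exact: size_set_nth_lt.
by move=> j _; rewrite nth_set_nth /=; case: eqP => [->|].
Qed.

Lemma nth_set_nth_eq s i (t : tape) : nth blank (set_nth blank s i t) i = t.
Proof. by rewrite nth_set_nth /= eqxx. Qed.

Lemma runs_shift_left i s l r : i < size s ->
  runs (shift i MoveLeft) (set_nth blank s i (zipper l r))
    (set_nth blank s i (left_of l r)) 1.
Proof.
move=> lt_i; set s' := set_nth _ _ _ (zipper _ _).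
have lt_i' : i < size s' by rewrite size_set_nth_lt.
have := runs_on (fun r => cell r i) MoveLeft lt_i'.
by rewrite cell_reads nth_set_nth_eq norm_act_left set_nth_same.
Qed.

Lemma runs_rewind_loop i s l r : i < size s ->
  runs (While (nonblank i) (shift i MoveLeft))
    (set_nth blank s i (left_of l r))
    (set_nth blank s i (left_of [::] (catrev l r))) (2 * size l + 1).
Proof.
move=> lt_i; elim: l r => [|a l IHl] r.
  apply: runs_whileF; rewrite /nonblank cell_reads nth_set_nth_eq.
  by case: r.
apply: runs_while_leq (runs_shift_left _ _ _) (IHl _) _ => //=; last by lia.
by rewrite /nonblank cell_reads nth_set_nth_eq.
Qed.

Lemma runs_rewind i s l r : i < size s -> nth blank s i = zipper l r ->
  runs (rewind i) s (set_nth blank s i (zipper [::] (catrev l r)))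
    (2 * size l + 3).
Proof.
move=> lt_i si; rewrite -{1}(set_nth_nth lt_i si).
apply: runs_seq_leq (runs_shift_left _ _ lt_i) _ _.
  apply: runs_seq (runs_rewind_loop _ _ lt_i) _.
  set s' := set_nth _ _ _ (left_of _ _).
  have lt_i' : i < size s' by rewrite size_set_nth_lt.
  have := runs_on (fun r => cell r i) MoveRight lt_i'.
  rewrite cell_reads nth_set_nth_eq set_nth_same.
  set t := norm_act _ _; suff -> : t = zipper [::] (catrev l r) by apply.
  by rewrite /t; case: (catrev l r).
by lia.
Qed.

Lemma nseq_catS (m : nat) (b : bool) u : nseq m b ++ b :: u = b :: nseq m b ++ u.
Proof. by elim: m => //= m ->. Qed.

Lemma runs_copy_ones i k s l m w v :
  i != k -> i < size s -> k < size s -> head false w = false ->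
  nth blank s i = zipper l (nseq m true ++ w) -> nth blank s k = zipper v [::] ->
  runs (copy_ones i k) s
    (set_nth blank (set_nth blank s k (zipper (nseq m true ++ v) [::]))
       i (zipper (nseq m true ++ l) w)) (3 * m + 1).
Proof.
move=> neq_ik lt_i lt_k w0.
elim: m s l v lt_i lt_k => [|m IHm] s l v lt_i lt_k si sk.
  rewrite (set_nth_nth lt_k sk) (set_nth_nth lt_i si); apply: runs_whileF.
  by rewrite /is_one cell_reads si; case: w w0 {si} => //= -[].
set s1 := set_nth blank s k (zipper (true :: v) [::]).
have lt_i1 : i < size s1 by rewrite size_set_nth_lt.
have s1i : nth blank s1 i = zipper l (nseq m.+1 true ++ w).
  by rewrite nth_set_nth /= (negPf neq_ik).
pose s2 := set_nth blank s1 i (zipper (true :: l) (nseq m true ++ w)).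
have lt_k1 : k < size s1 by rewrite size_set_nth_lt.
apply: (@runs_while_leq 2 (3 * m + 1) _ _ _ _ s2); last by lia.
- by rewrite /is_one cell_reads si.
- apply: (@runs_seq_leq 1 1 _ _ _ _ s1) => //.
    by have := runs_on (fun=> Some true) MoveRight lt_k; rewrite sk.
  have := runs_on (fun r => cell r i) MoveRight lt_i1.
  by rewrite cell_reads s1i.
have := IHm s2 (true :: l) (true :: v).
rewrite !size_set_nth_lt // => /(_ lt_i lt_k).
rewrite nth_set_nth_eq nth_set_nth /= eq_sym (negPf neq_ik) nth_set_nth_eq.
move=> /(_ erefl erefl).
rewrite !nseq_catS; congr runs.
rewrite /s2 /s1 [set_nth _ (set_nth _ (set_nth _ s _ _) _ _) k _]set_set_nth.
by rewrite (negPf neq_ik) !set_nth_same.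
Qed.

(* tI: input; tV: for a fixed bit and index, the positions where it is allowed; *)
(* tX: bits of the current query; tJ: 1^j 0 for the current index j; tC: counts *)
(* allowed pairs; tD: amount to subtract; tA: product so far; tR: next product; *)
(* tK: carry; tL: remaining rounds. *)
Notation tI := 0 (only parsing).
Notation tV := 1 (only parsing).
Notation tX := 2 (only parsing).
Notation tJ := 3 (only parsing).
Notation tC := 4 (only parsing).
Notation tD := 5 (only parsing).
Notation tA := 6 (only parsing).
Notation tR := 7 (only parsing).
Notation tK := 8 (only parsing).
Notation tL := 9 (only parsing).

Definition carry_tape (c : bool) : tape :=
  if c then zipper [::] [:: true] else blank.

(** The tape [ones m] with its head moved back onto the last 1, ready for loops that erase a 1 in
    each pass. *)
Definition countdown (m : nat) : tape :=
  if m is m'.+1 then zipper (nseq m' true) [:: true] else blank.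

(** One step treats a whole digit, with blanks counting as 0 in the sum. The loop stops once the
    addend is exhausted and no carry is left. *)
Definition add_loop : cmd :=
  While (fun r => nonblank tA r || is_one tK r)
    (Do (fun r j =>
       let a := is_one tA r in let x := is_one tR r in let c := is_one tK r in
       if j == tR then Some (Some (a (+) x (+) c), MoveRight)
       else if j == tK then
         Some (if majority a x c then Some true else None, MoveStay)
       else if j == tA then
         Some (cell r tA, if nonblank tA r then MoveRight else MoveStay)
       else None)).

Definition add : cmd := add_loop;; rewind tA;; rewind tR.

Definition multiply : cmd := While (is_one tC) (put tC None MoveLeft;; add).

(** The word on [tV] serves as a ruler of length n + 1: the dummy bit and the n bits of the
    query. *)
Definition read_bits : cmd :=
  While (nonblank tV)
    (on tX (fun r => cell r tI) MoveRight;;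
     shift tI MoveRight;; shift tV MoveRight).

(* Leaves the head of [tJ] at cell [minn s j.+1], which reads 1, 0 or blank *)
(* according to whether the score [s] is smaller than, equal to or greater *)
(* than [j]. *)
Definition read_score : cmd :=
  While (is_one tI)
    (shift tI MoveRight;; If (nonblank tJ) (shift tJ MoveRight) skip).

Definition update (b : bool) (q : symbol) (v x : bool) : bool :=
  v && (if q is Some c then c || (x != b) else x == b).

Definition update_bits (b : bool) : cmd :=
  While (nonblank tV)
    (on tV (fun r => Some (update b (cell r tJ) (is_one tV r) (is_one tX r)))
        MoveLeft;;
     put tX None MoveLeft).

(** The first move steps back onto the 0 before the query, which is the dummy bit; the later move of
    [tI] to the right skips the 0 that closes the score. *)
Definition query (b : bool) : cmd :=
  shift tI MoveLeft;; read_bits;; read_score;; shift tI MoveRight;;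
  shift tV MoveLeft;; shift tX MoveLeft;; update_bits b;; shift tV MoveRight;;
  rewind tJ.

Definition count_bits : cmd :=
  While (nonblank tV)
    (If (is_one tV) (put tC (Some true) MoveRight) skip;; put tV None MoveRight).

(** The first cell of [tV] belongs to the dummy position and is one summand of [overlap], so a 1
    there adds [j] to the amount to subtract. The other cells are genuine positions. *)
Definition tally_bits : cmd :=
  If (is_one tV) (copy_ones tJ tD;; rewind tJ) skip;;
  put tV None MoveRight;; count_bits.

Definition pass (b : bool) : cmd :=
  copy_ones tI tV;; put tV (Some true) MoveRight;; rewind tV;;
  shift tI MoveRight;; While (nonblank tI) (query b);; rewind tI;; tally_bits.

Definition subtract : cmd :=
  While (is_one tD)
    (put tD None MoveLeft;; shift tC MoveLeft;; put tC None MoveStay).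

Definition replace_product : cmd :=
  While (nonblank tA) (put tA None MoveRight);;
  While (nonblank tR)
    (on tA (fun r => cell r tR) MoveRight;; put tR None MoveRight);;
  rewind tA.

Definition next_index : cmd :=
  While (is_one tJ) (shift tJ MoveRight);; put tJ (Some true) MoveRight;;
  put tJ (Some false) MoveStay;; rewind tJ.

Definition round : cmd :=
  pass false;; pass true;; shift tD MoveLeft;; subtract;; shift tC MoveLeft;;
  multiply;; replace_product;; next_index.

Definition count_secrets : cmd :=
  copy_ones tI tL;; shift tL MoveLeft;; rewind tI;;
  put tJ (Some false) MoveStay;; put tA (Some true) MoveStay;;
  While (is_one tL) (round;; put tL None MoveLeft).

Definition to_end (i : nat) : cmd := While (nonblank i) (shift i MoveRight).

(** The answer is written just after the input, where a blank follows it. Since binary 0 is the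
    empty word, the first cell of [tA] decides whether the product is nonzero. *)
Definition write_nonzero : cmd :=
  to_end tI;; on tI (fun r => Some (nonblank tA r)) MoveStay.

(** Digits are copied from the most significant one leftwards, starting on the blank after the input
    and overwriting the input. The result is thus followed by a blank, and the last move puts the
    head on its first digit. *)
Definition write_product : cmd :=
  to_end tI;; to_end tA;; shift tA MoveLeft;;
  While (nonblank tA) (on tI (fun r => cell r tA) MoveLeft;; shift tA MoveLeft);;
  shift tI MoveRight.

(** * Effect and running time of the single loops *)

Lemma runs_on_seq i f m c s s' T : i < size s ->
  runs c (set_nth blank s i (norm_act (f (reads s), m) (nth blank s i))) s' T ->
  runs (on i f m;; c) s s' T.+1.
Proof. by move=> /(runs_on f m) r1 r2; rewrite -add1n; apply: runs_seq r1 r2. Qed.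

Ltac steps :=
  repeat (apply: runs_on_seq; first exact: isT); exact: runs_on.

(** [u] consists of the digits that the loop writes, [v] of the final digits of [r] that it never
    reaches. *)
Lemma runs_add_loop I V X J C D L a r c la lr :
  exists u v, add_bits a r c = u ++ v /\
  runs add_loop
    [:: I; V; X; J; C; D; zipper la a; zipper lr r; carry_tape c; L]
    [:: I; V; X; J; C; D; zipper (catrev a la) [::]; zipper (catrev u lr) v;
        blank; L] (2 * size u + 1).
Proof.
elim: a r c la lr => [|a s IH] r c la lr.
  elim: r c lr => [|x r IHr] [] lr.
  - exists [:: true], [::]; split=> //.
    apply: (@runs_while_leq 1 1) => //; first exact: runs_do.
    exact: runs_whileF.
  - by exists [::], [::]; split=> //; apply: runs_whileF.
  - have [u [v [E r1]]] := IHr x (~~ x :: lr).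
    exists (~~ x :: u), v; split; first by rewrite /= -E.
    apply: (@runs_while_leq 1 _ _ _ _ _ _ _ _ _ r1) => //=; last by lia.
    by case: x {r1 E}; exact: runs_do.
  - by exists [::], (x :: r); split=> //; apply: runs_whileF.
have [u [v [E r1]]] := IH (behead r) (majority a (head false r) c) (a :: la)
  (a (+) head false r (+) c :: lr).
exists (a (+) head false r (+) c :: u), v; split; first by rewrite /= E.
apply: (@runs_while_leq 1 _ _ _ _ _ _ _ _ _ r1) => //=; last by lia.
by case: c r a {r1 E} => -[|[] r] []; exact: runs_do.
Qed.

Lemma runs_add I V X J C D L a r :
  runs add [:: I; V; X; J; C; D; zipper [::] a; zipper [::] r; blank; L]
    [:: I; V; X; J; C; D; zipper [::] a; zipper [::] (add_bits a r false);
        blank; L] (2 * size a + 4 * size (add_bits a r false) + 7).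
Proof.
have [u [v [E r1]]] := runs_add_loop I V X J C D L a r false [::] [::].
rewrite !catrevE !cats0 in r1; rewrite E.
have r2 := @runs_rewind 6
  [:: I; V; X; J; C; D; zipper (rev a) [::]; zipper (rev u) v; blank; L]
  (rev a) [::] isT erefl.
have r3 := @runs_rewind 7
  [:: I; V; X; J; C; D; zipper [::] a; zipper (rev u) v; blank; L]
  (rev u) v isT erefl.
rewrite catrevE revK cats0 in r2; rewrite catrevE revK in r3.
apply: (runs_seq_leq r1 (runs_seq r2 r3)).
by rewrite size_cat !size_rev; lia.
Qed.

Lemma runs_read_bits I' x w lv v lx J C D A R K L : size x = size v ->
  runs read_bits
    [:: zipper I' (x ++ w); zipper lv v; zipper lx [::]; J; C; D; A; R; K; L]
    [:: zipper (catrev x I') w; zipper (catrev v lv) [::];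
        zipper (catrev x lx) [::]; J; C; D; A; R; K; L] (4 * size v + 1).
Proof.
elim: x v I' lv lx => [|a x IH] [|b v] // I' lv lx.
  by move=> _; apply: runs_whileF.
move=> [/(IH _ (a :: I') (b :: lv) (a :: lx)) r1].
apply: (@runs_while_leq 3 _ _ _ _ _ _ _ _ _ r1) => //=; last by lia.
by steps.
Qed.

Lemma runs_read_score I' s w V X lj j C D A R K L :
  runs read_score
    [:: zipper I' (nseq s true ++ false :: w); V; X; zipper lj j; C; D; A; R; K; L]
    [:: zipper (nseq s true ++ I') (false :: w); V; X;
        zipper (catrev (take s j) lj) (drop s j); C; D; A; R; K; L] (4 * s + 1).
Proof.
elim: s I' lj j => [|s IH] I' lj j.
  by rewrite take0 drop0; apply: runs_whileF.
case: j => [|b j].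
  have := IH (true :: I') lj [::]; rewrite nseq_catS => r1.
  apply: (@runs_while_leq 3 _ _ _ _ _ _ _ _ _ r1) => //=; last by lia.
  apply: runs_on_seq => //.
  by apply: runs_ifF => //; exact: runs_do.
have := IH (true :: I') (b :: lj) j; rewrite nseq_catS => r1.
apply: (@runs_while_leq 3 _ _ _ _ _ _ _ _ _ r1) => //=; last by lia.
apply: runs_on_seq => //.
by apply: runs_ifT => //; exact: runs_on.
Qed.

Lemma runs_update_bits b I p r J C D A R K L :
  let left_v := left_of (unzip1 p) r in
  let left_x := left_of (unzip2 p) [::] in
  let q := scan J in
  runs (update_bits b) [:: I; left_v; left_x; J; C; D; A; R; K; L]
    [:: I; left_of [::] (catrev [seq update b q y.1 y.2 | y <- p] r); blank;
        J; C; D; A; R; K; L] (3 * size p + 1).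
Proof.
move=> /=; elim: p r => [|[v x] p IH] r.
  by apply: runs_whileF => /=; case: r.
have r1 := IH (update b (scan J) v x :: r).
apply: (@runs_while_leq 2 _ _ _ _ _ _ _ _ _ r1) => //=; last by lia.
case: p {IH r1} => [|[v' x'] p] /=; case: v; case: x; steps.
Qed.

Lemma runs_count_bits I v X J c D A R K L :
  runs count_bits [:: I; zipper [::] v; X; J; ones c; D; A; R; K; L]
    [:: I; blank; X; J; ones (count id v + c); D; A; R; K; L] (4 * size v + 1).
Proof.
elim: v c => [|[] v IH] c; first exact: runs_whileF.
  have r1 := IH c.+1; rewrite addnS in r1.
  apply: (@runs_while_leq 3 _ _ _ _ _ _ _ _ _ r1) => //=; last by lia.
  apply: runs_seq_leq;
    [by apply: runs_ifT; last exact: runs_on | exact: runs_on | by []].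
have r1 := IH c.
apply: (@runs_while_leq 3 _ _ _ _ _ _ _ _ _ r1) => //=; last by lia.
apply: runs_seq_leq;
  [by apply: runs_ifF; last exact: runs_do | exact: runs_on | by []].
Qed.

(** Once [tC] is exhausted the moves only pass over blanks, which yields the truncated subtraction
    used in [choices]. *)
Lemma runs_subtract I V X J c d A R K L :
  runs subtract [:: I; V; X; J; ones c; countdown d; A; R; K; L]
    [:: I; V; X; J; ones (c - d); blank; A; R; K; L] (4 * d + 1).
Proof.
elim: d c => [|d IH] c; first by rewrite subn0; apply: runs_whileF.
have r1 := IH c.-1; rewrite -subn1 -subnDA add1n in r1.
apply: (@runs_while_leq 3 _ _ _ _ _ _ _ _ _ r1) => //=; last by lia.
by case: d {IH r1} => [|d]; case: c => [|[|c]]; steps.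
Qed.

(** The partial sums only grow, so a bound [M] on the length of the final one bounds the cost of
    every addition. *)
Lemma runs_multiply I V X J c D a r L M :
  size (binary (r + c * a)) <= M ->
  runs multiply
    [:: I; V; X; J; countdown c; D; zipper [::] (binary a);
        zipper [::] (binary r); blank; L]
    [:: I; V; X; J; blank; D; zipper [::] (binary a);
        zipper [::] (binary (r + c * a)); blank; L] (c * (6 * M + 9) + 1).
Proof.
elim: c r => [|c IH] r le_M; first by rewrite addn0; apply: runs_whileF.
(* The [0] is the initial carry, in the form given by [add_bits_binary]. *)
have E : r + c.+1 * a = a + r + 0 + c * a by lia.
rewrite E in le_M *; have r1 := IH _ le_M.
have r2 := runs_add I V X J (countdown c) D L (binary a) (binary r).
rewrite add_bits_binary [nat_of_bool _]/= in r2.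
have size_le m m' : m <= m' -> size (binary m) <= size (binary m').
  by rewrite !size_mkseq => le_m; rewrite leq_up_log.
have le1 : size (binary a) <= M by apply: leq_trans le_M; apply: size_le; lia.
have le2 : size (binary (a + r + 0)) <= M.
  by apply: leq_trans le_M; apply: size_le; lia.
apply: (@runs_while_leq (6 * M + 8) _ _ _ _ _ _ _ _ _ r1) => //=; last by lia.
apply: (@runs_seq_leq 1 _ _ _ _ _ _ _ _ r2); last by lia.
by case: c {IH E le_M r1 le2 r2} => [|c]; exact: runs_on.
Qed.

(** * One round of the program *)

Definition index_word (j : nat) : seq bool := nseq j true ++ [:: false].

Lemma catrev_nseq (m : nat) (b : bool) u : catrev (nseq m b) u = nseq m b ++ u.
Proof. by rewrite catrevE rev_nseq. Qed.

Lemma left_of_ones m : left_of (nseq m true) [::] = countdown m.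
Proof. by case: m. Qed.

Lemma runs_shift_right i s r : i < size s ->
  runs (shift i MoveRight) (set_nth blank s i (left_of [::] r))
    (set_nth blank s i (zipper [::] r)) 1.
Proof.
move=> lt_i; set s' := set_nth _ _ _ (left_of _ _).
have lt_i' : i < size s' by rewrite size_set_nth_lt.
have := runs_on (fun r => cell r i) MoveRight lt_i'.
by rewrite cell_reads nth_set_nth_eq set_nth_same; case: (r).
Qed.

Lemma update_compatible b j s v x :
  update b (nth None (map Some (index_word j)) s) v x =
  v && compatible b j x s.
Proof.
rewrite /update /compatible /index_word map_cat nth_cat size_map size_nseq.
case: ltngtP => [lt_sj|lt_js|->]; last by rewrite subnn.
  by rewrite map_nseq nth_nseq lt_sj.
by rewrite nth_default //= subn_gt0.
Qed.

Definition query_bits (b : bool) (j s : nat) (v x : seq bool) : seq bool :=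
  [seq y.1 && compatible b j y.2 s | y <- zip v (false :: x)].

Lemma runs_query b l x s w v j C D A R K L : size v = (size x).+1 ->
  runs (query b)
    [:: zipper (false :: l) (x ++ nseq s true ++ false :: w); zipper [::] v;
        blank; zipper [::] (index_word j); C; D; A; R; K; L]
    [:: zipper (false :: catrev (x ++ nseq s true) (false :: l)) w;
        zipper [::] (query_bits b j s v x);
        blank; zipper [::] (index_word j); C; D; A; R; K; L]
    (7 * size x + 4 * s + 2 * j + 20).
Proof.
(* [x0] includes the dummy bit before the query; the pairs are reversed because the update runs from
   right to left. *)
move=> sv; pose x0 := false :: x; pose p := rev (zip v x0).
have sx0 : size x0 = size v by rewrite sv.
have r1 := @runs_shift_left 0
  [:: blank; zipper [::] v; blank; zipper [::] (index_word j); C; D; A; R; K; L]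
  (false :: l) (x ++ nseq s true ++ false :: w) isT.
have r2 := @runs_read_bits l x0 (nseq s true ++ false :: w) [::] v [::]
  (zipper [::] (index_word j)) C D A R K L sx0.
have r3 := @runs_read_score (catrev x0 l) s w (zipper (rev v) [::])
  (zipper (rev x0) [::]) [::] (index_word j) C D A R K L.
have r5 := @runs_shift_left 1
  [:: zipper (false :: nseq s true ++ catrev x0 l) w; zipper (rev v) [::];
      zipper (rev x0) [::];
      zipper (rev (take s (index_word j))) (drop s (index_word j));
      C; D; A; R; K; L] (rev v) [::] isT.
have r6 := @runs_shift_left 2
  [:: zipper (false :: nseq s true ++ catrev x0 l) w; left_of (rev v) [::];
      zipper (rev x0) [::];
      zipper (rev (take s (index_word j))) (drop s (index_word j));
      C; D; A; R; K; L] (rev x0) [::] isT.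
have r7 := @runs_update_bits b (zipper (false :: nseq s true ++ catrev x0 l) w)
  p [::] (zipper (rev (take s (index_word j))) (drop s (index_word j)))
  C D A R K L.
have E1 : unzip1 p = rev v.
  by rewrite /p /unzip1 map_rev -/unzip1 unzip1_zip ?sx0.
have E2 : unzip2 p = rev x0.
  by rewrite /p /unzip2 map_rev -/unzip2 unzip2_zip ?sx0.
have E3 : catrev [seq update b (scan (zipper (rev (take s (index_word j)))
      (drop s (index_word j)))) y.1 y.2 | y <- p] [::] = query_bits b j s v x.
  rewrite /p map_rev -/(rev _) revK; apply: eq_map => y.
  rewrite -update_compatible; congr update.
  by rewrite /scan /= -nth0 map_drop nth_drop addn0.
rewrite /= E1 E2 E3 in r7.
have r8 := @runs_shift_right 1
  [:: zipper (false :: nseq s true ++ catrev x0 l) w; blank; blank;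
      zipper (rev (take s (index_word j))) (drop s (index_word j));
      C; D; A; R; K; L] (query_bits b j s v x) isT.
have r9 := @runs_rewind 3
  [:: zipper (false :: nseq s true ++ catrev x0 l) w;
      zipper [::] (query_bits b j s v x); blank;
      zipper (rev (take s (index_word j))) (drop s (index_word j));
      C; D; A; R; K; L] (rev (take s (index_word j))) (drop s (index_word j))
  isT erefl.
rewrite [catrev (rev _) _]catrevE revK cat_take_drop in r9.
have -> : catrev (x ++ nseq s true) (false :: l) = nseq s true ++ catrev x0 l.
  by rewrite !catrevE /x0 rev_cat rev_nseq rev_cons cat_rcons catA.
have le_take : size (rev (take s (index_word j))) <= j.+1.
  by rewrite size_rev size_take_min size_cat size_nseq addn1 geq_minr.
apply: runs_leq.
  apply: (runs_seq r1); apply: (runs_seq r2); apply: (runs_seq r3).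
  apply: runs_on_seq => //; apply: (runs_seq r5); apply: (runs_seq r6).
  exact: (runs_seq r7 (runs_seq r8 r9)).
rewrite !size_rev in le_take *; rewrite size_zip sx0 minnn sv; lia.
Qed.

(** * One pass over the whole history *)

Section History.
Variable n : nat.
Implicit Types H : history n.

Definition code H : seq bool :=
  flatten [seq val g.1 ++ rcons (nseq g.2 true) false | g : guess n <- H].

Lemma size_code H : size (code H) <= size H * (2 * n + 1).
Proof.
elim: H => //= g H IH; rewrite size_cat mulSn leq_add //.
by rewrite size_cat size_rcons size_nseq size_tuple; have := ltn_ord g.2; lia.
Qed.

Lemma code_cons (g : guess n) H :
  code (g :: H) = g.1 ++ nseq g.2 true ++ false :: code H.
Proof. by rewrite /code /= -cats1 -!catA. Qed.

(** Entry 0 is the dummy position; entry [i + 1] is position [i]. *)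
Definition survivors H (b : bool) (j : nat) : seq bool :=
  mkseq (fun i => all (fun g : guess n =>
    compatible b j (nth false (false :: g.1) i) g.2) H) n.+1.

Lemma foldl_query_bits H b j v : size v = n.+1 ->
  foldl (fun v (g : guess n) => query_bits b j g.2 v g.1) v H =
  [seq y.1 && y.2 | y <- zip v (survivors H b j)].
Proof.
elim: H v => [|g H IH] v sv; rewrite [LHS]/=.
  rewrite /survivors; apply: (@eq_from_nth _ false).
    by rewrite size_map size_zip size_mkseq sv minnn.
  move=> i; rewrite sv => lt_i.
  rewrite (nth_map (false, false)) ?size_zip ?size_mkseq ?sv ?minnn //.
  by rewrite nth_zip ?size_mkseq ?sv //= nth_mkseq // andbT.
have sx : size (false :: g.1) = n.+1 by rewrite /= size_tuple.
have sq : size (query_bits b j g.2 v g.1) = n.+1.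
  by rewrite size_map size_zip sv sx minnn.
rewrite IH //; apply: (@eq_from_nth _ false).
  by rewrite !size_map !size_zip !size_mkseq sq sv.
move=> i; rewrite size_map size_zip size_mkseq sq minnn => lt_i.
rewrite !(nth_map (false, false)) ?size_zip ?size_mkseq ?sv ?sq ?minnn //.
rewrite !nth_zip ?size_mkseq ?sv ?sq //= !nth_mkseq //= andbA; congr (_ && _).
rewrite (nth_map (false, false)) ?size_zip ?sv ?sx ?minnn //.
by rewrite nth_zip ?sv.
Qed.

Lemma runs_queries b l H v j C D A R K L : size v = n.+1 -> j <= n ->
  runs (While (nonblank tI) (query b))
    [:: zipper (false :: l) (code H); zipper [::] v; blank;
        zipper [::] (index_word j); C; D; A; R; K; L]
    [:: zipper (catrev (code H) (false :: l)) [::];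
        zipper [::] (foldl (fun v (g : guess n) => query_bits b j g.2 v g.1) v H);
        blank; zipper [::] (index_word j); C; D; A; R; K; L]
    (size H * (13 * n + 21) + 1).
Proof.
move=> sv le_j; elim: H l v sv => [|g H IH] l v sv; first exact: runs_whileF.
rewrite code_cons.
have sx : size v = (size g.1).+1 by rewrite size_tuple.
have r1 := @runs_query b l g.1 g.2 (code H) v j C D A R K L sx.
have sv' : size (query_bits b j g.2 v g.1) = n.+1.
  by rewrite size_map size_zip /= sv size_tuple minnn.
have r2 := IH (catrev (g.1 ++ nseq g.2 true) (false :: l)) _ sv'.
have -> : catrev (g.1 ++ nseq g.2 true ++ false :: code H) (false :: l) =
    catrev (code H) (false :: catrev (g.1 ++ nseq g.2 true) (false :: l)).
  by rewrite catA [LHS]catrev_catl.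
apply: runs_while_leq r1 r2 _.
  (* The loop test succeeds even for n = 0, since the code of a query contains the 0 closing its
     score. *)
  by case: (val g.1) => //; case: (nat_of_ord g.2).
by rewrite size_tuple /=; have := ltn_ord g.2; lia.
Qed.

Lemma runs_tally I v0 v X j c d A R K L :
  runs tally_bits
    [:: I; zipper [::] (v0 :: v); X; zipper [::] (index_word j); ones c; ones d;
        A; R; K; L]
    [:: I; blank; X; zipper [::] (index_word j); ones (count id v + c);
        ones (j * v0 + d); A; R; K; L] (4 * size v + 5 * j + 10).
Proof.
have r1 := @runs_count_bits I v X (zipper [::] (index_word j)) c
  (ones (j * v0 + d)) A R K L.
suff r2 : runs (If (is_one tV) (copy_ones tJ tD;; rewind tJ) skip)
    [:: I; zipper [::] (v0 :: v); X; zipper [::] (index_word j); ones c; ones d;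
        A; R; K; L]
    [:: I; zipper [::] (v0 :: v); X; zipper [::] (index_word j); ones c;
        ones (j * v0 + d); A; R; K; L] (5 * j + 5).
  apply: (runs_seq_leq r2); first by apply: runs_on_seq => //; exact: r1.
  by lia.
case: v0 {r1}; last first.
  rewrite muln0; apply: (@runs_leq _ _ _ 2); last by lia.
  by apply: runs_ifF => //; exact: runs_do.
have r3 := @runs_copy_ones 3 5
  [:: I; zipper [::] (true :: v); X; zipper [::] (index_word j); ones c; ones d;
      A; R; K; L] [::] j [:: false] (nseq d true) isT isT isT erefl erefl erefl.
have r4 := @runs_rewind 3
  [:: I; zipper [::] (true :: v); X; zipper (nseq j true) [:: false]; ones c;
      ones (j + d); A; R; K; L] (nseq j true) [:: false] isT erefl.
rewrite -nseqD cats0 in r3; rewrite catrev_nseq size_nseq in r4; rewrite muln1.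
apply: (@runs_leq _ _ _ (3 * j + 1 + (2 * j + 3)).+1); last by lia.
by apply: runs_ifT => //; exact: (runs_seq r3 r4).
Qed.

Definition pass_time (t : nat) : nat := (t + 1) * (17 * n + 40).

Lemma runs_pass H b j c d A R K L : j <= n ->
  runs (pass b)
    [:: zipper [::] (encode H); blank; blank; zipper [::] (index_word j);
        ones c; ones d; A; R; K; L]
    [:: zipper [::] (encode H); blank; blank; zipper [::] (index_word j);
        ones (count id (behead (survivors H b j)) + c);
        ones (j * head false (survivors H b j) + d); A; R; K; L]
    (pass_time (size H)).
Proof.
move=> le_j; have E : encode H = nseq n true ++ false :: code H.
  by rewrite /encode -/(code H) cat_rcons.
rewrite {1}E.
have r1 := @runs_copy_ones 0 1
  [:: zipper [::] (nseq n true ++ false :: code H); blank; blank;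
      zipper [::] (index_word j); ones c; ones d; A; R; K; L]
  [::] n (false :: code H) [::] isT isT isT erefl erefl erefl.
rewrite !cats0 in r1.
have r3 := @runs_rewind 1
  [:: zipper (nseq n true) (false :: code H); zipper (nseq n.+1 true) [::]; blank;
      zipper [::] (index_word j); ones c; ones d; A; R; K; L]
  (nseq n.+1 true) [::] isT erefl.
rewrite catrev_nseq cats0 size_nseq in r3.
have r5 := @runs_queries b (nseq n true) H (nseq n.+1 true) j (ones c) (ones d)
  A R K L (size_nseq _ _) le_j.
(* Starting from all ones, the conjunction is [survivors] itself, split here into the dummy entry
   and the rest. *)
have Ev : foldl (fun v (g : guess n) => query_bits b j g.2 v g.1) (nseq n.+1 true) H
    = head false (survivors H b j) :: behead (survivors H b j).
  rewrite foldl_query_bits ?size_nseq //.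
  have : size (survivors H b j) = n.+1 by rewrite size_mkseq.
  case: (survivors H b j) => // a s [<-] /=; congr (_ :: _).
  by elim: s => //= a' s ->.
rewrite Ev in r5.
have r6 := @runs_rewind 0
  [:: zipper (catrev (code H) (false :: nseq n true)) [::];
      zipper [::] (head false (survivors H b j) :: behead (survivors H b j));
      blank; zipper [::] (index_word j); ones c; ones d; A; R; K; L]
  (catrev (code H) (false :: nseq n true)) [::] isT erefl.
have Ew : catrev (catrev (code H) (false :: nseq n true)) [::] = encode H.
  rewrite E [catrev (code H) _]catrevE [LHS]catrevE cats0 rev_cat revK.
  by rewrite rev_cons rev_nseq cat_rcons.
rewrite Ew in r6.
have r7 := @runs_tally (zipper [::] (encode H)) (head false (survivors H b j))
  (behead (survivors H b j)) blank j c d A R K L.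
apply: runs_leq.
  apply: (runs_seq r1); apply: runs_on_seq => //; apply: (runs_seq r3).
  by apply: runs_on_seq => //; exact: (runs_seq r5 (runs_seq r6 r7)).
rewrite catrevE size_cat size_rev size_behead size_mkseq /= size_nseq.
by have := size_code H; rewrite /pass_time; nia.
Qed.

End History.

Lemma runs_erase_product I V X J C D a R K L :
  runs (While (nonblank tA) (put tA None MoveRight))
    [:: I; V; X; J; C; D; zipper [::] a; R; K; L]
    [:: I; V; X; J; C; D; blank; R; K; L] (2 * size a + 1).
Proof.
elim: a => [|x a IH]; first exact: runs_whileF.
by apply: (@runs_while_leq 1 _ _ _ _ _ _ _ _ _ IH) => //=; [exact: runs_on | lia].
Qed.

Lemma runs_move_product I V X J C D la r K L :
  runs
    (While (nonblank tR)
      (on tA (fun r => cell r tR) MoveRight;; put tR None MoveRight))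
    [:: I; V; X; J; C; D; zipper la [::]; zipper [::] r; K; L]
    [:: I; V; X; J; C; D; zipper (catrev r la) [::]; blank; K; L] (3 * size r + 1).
Proof.
elim: r la => [|x r IH] la; first exact: runs_whileF.
apply: (@runs_while_leq 2 _ _ _ _ _ _ _ _ _ (IH (x :: la))) => //=; last by lia.
by steps.
Qed.

Lemma runs_replace_product I V X J C D a r K L :
  runs replace_product
    [:: I; V; X; J; C; D; zipper [::] a; zipper [::] r; K; L]
    [:: I; V; X; J; C; D; zipper [::] r; blank; K; L]
    (2 * size a + 5 * size r + 5).
Proof.
have r1 := runs_erase_product I V X J C D a (zipper [::] r) K L.
have r2 := runs_move_product I V X J C D [::] r K L.
have r3 := @runs_rewind 6
  [:: I; V; X; J; C; D; zipper (rev r) [::]; blank; K; L] (rev r) [::] isT erefl.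
rewrite catrevE revK cats0 size_rev in r3.
apply: runs_leq; first exact: (runs_seq r1 (runs_seq r2 r3)).
by lia.
Qed.

Lemma runs_skip_ones I V X l j C D A R K L :
  runs (While (is_one tJ) (shift tJ MoveRight))
    [:: I; V; X; zipper l (index_word j); C; D; A; R; K; L]
    [:: I; V; X; zipper (nseq j true ++ l) [:: false]; C; D; A; R; K; L]
    (2 * j + 1).
Proof.
elim: j l => [|j IH] l; first exact: runs_whileF.
have r1 := IH (true :: l); rewrite nseq_catS in r1.
apply: (@runs_while_leq 1 _ _ _ _ _ _ _ _ _ r1) => //=; last by lia.
exact: runs_on.
Qed.

Lemma runs_next_index I V X j C D A R K L :
  runs next_index
    [:: I; V; X; zipper [::] (index_word j); C; D; A; R; K; L]
    [:: I; V; X; zipper [::] (index_word j.+1); C; D; A; R; K; L] (4 * j + 8).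
Proof.
have r1 := runs_skip_ones I V X [::] j C D A R K L.
have r4 := @runs_rewind 3
  [:: I; V; X; zipper (true :: nseq j true) [:: false]; C; D; A; R; K; L]
  (nseq j.+1 true) [:: false] isT erefl.
rewrite catrev_nseq size_nseq in r4; rewrite cats0 in r1.
apply: runs_leq.
  apply: (runs_seq r1); apply: runs_on_seq => //; apply: runs_on_seq => //.
  exact: r4.
by lia.
Qed.

(** * From one factor to the whole product *)

Section Rounds.
Variables (n : nat) (H : history n).

Lemma count_survivors b j :
  count id (behead (survivors H b j)) = #|[pred p | allowed H j (p, b)]|.
Proof.
rewrite /survivors /mkseq /= (iotaDl 1 0) -map_comp -val_enum_ord -map_comp.
rewrite !count_map cardE /enum_mem size_filter -enumT; apply: eq_count => p.
by rewrite /= inE; apply: eq_all => g; rewrite (tnth_nth false).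
Qed.

(** The right-hand side is what the two passes leave on [tC] and [tD], with [+ 0] for the initially
    empty tapes: allowed pairs are counted separately for each bit, and the dummy entries are the
    two summands of [overlap]. *)
Lemma choices_survivors j :
  choices H j =
  count id (behead (survivors H true j)) +
    (count id (behead (survivors H false j)) + 0) -
  (j * head false (survivors H true j) + (j * head false (survivors H false j) + 0)).
Proof.
rewrite !count_survivors !addn0 -mulnDr addnC [_ + nat_of_bool _]addnC.
congr (_ - _).
transitivity (\sum_p \sum_(b : bool) (allowed H j (p, b) : nat)).
  rewrite pair_bigA -sum1_card big_mkcond; apply: eq_bigr => -[p b] _ /=.
  by rewrite inE; case: allowed.
rewrite (eq_bigr (fun p => allowed H j (p, false) + allowed H j (p, true)));
  last by move=> p _; rewrite big_bool /= addnC.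
rewrite big_split.
by congr (_ + _); rewrite -sum1_card [RHS]big_mkcond; apply: eq_bigr => p _;
  rewrite inE; case: allowed.
Qed.

Definition round_time (t M : nat) : nat :=
  2 * pass_time n t + 2 * n * (6 * M + 9) + 7 * M + 12 * n + 20.

Definition between_rounds (j a m : nat) : store :=
  [:: zipper [::] (encode H); blank; blank; zipper [::] (index_word j); blank;
      blank; zipper [::] (binary a); blank; blank; countdown m].

Lemma choices_leq j : choices H j <= 2 * n.
Proof.
apply: leq_trans (leq_subr _ _) _; apply: leq_trans (max_card _) _.
by rewrite card_prod card_ord card_bool mulnC.
Qed.

Lemma runs_round j a m M : j < n ->
  size (binary a) <= M -> size (binary (a * choices H j)) <= M ->
  runs round (between_rounds j a m) (between_rounds j.+1 (a * choices H j) m)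
    (round_time (size H) M).
Proof.
move=> lt_jn le_a le_aM.
pose I := zipper [::] (encode H); pose J := zipper [::] (index_word j).
pose A := zipper [::] (binary a); pose L := countdown m.
pose c0 := count id (behead (survivors H false j)) + 0.
pose d0 := j * head false (survivors H false j) + 0.
pose c1 := count id (behead (survivors H true j)) + c0.
pose d1 := j * head false (survivors H true j) + d0.
have r1 := @runs_pass n H false j 0 0 A blank blank L (ltnW lt_jn).
have r2 := @runs_pass n H true j c0 d0 A blank blank L (ltnW lt_jn).
have r3 := @runs_shift_left 5
  [:: I; blank; blank; J; ones c1; blank; A; blank; blank; L]
  (nseq d1 true) [::] isT.
have r4 := @runs_subtract I blank blank J c1 d1 A blank blank L.
have r5 := @runs_shift_left 4
  [:: I; blank; blank; J; blank; blank; A; blank; blank; L]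
  (nseq (c1 - d1) true) [::] isT.
rewrite left_of_ones in r3; rewrite left_of_ones in r5.
have E : c1 - d1 = choices H j by rewrite choices_survivors.
have r6 := @runs_multiply I blank blank J (c1 - d1) blank a 0 L M.
rewrite E add0n mulnC in r6; rewrite E in r4 r5.
have r7 := @runs_replace_product I blank blank J blank blank (binary a)
  (binary (a * choices H j)) blank L.
have r8 := @runs_next_index I blank blank j blank blank
  (zipper [::] (binary (a * choices H j))) blank blank L.
apply: runs_leq.
  apply: (runs_seq r1); apply: (runs_seq r2); apply: (runs_seq r3).
  apply: (runs_seq r4); apply: (runs_seq r5); apply: (runs_seq (r6 le_aM)).
  exact: (runs_seq r7 r8).
have le_d : d1 <= 2 * n.
  by rewrite /d1 /d0; case: (head _ _); case: (head _ _); lia.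
have le_c := leq_mul (choices_leq j) (leqnn (6 * M + 9)).
by rewrite /round_time; lia.
Qed.

(** Each factor is at most 2n < 2^(2n), so the product is at most 2^(2nj). This is crude, but a
    polynomial length suffices. *)
Lemma size_product j : j <= n ->
  size (binary (\prod_(i < j) choices H i)) <= 2 * n * n + 1.
Proof.
move=> le_jn; apply: size_binary.
apply: (@leq_ltn_trans (2 ^ (2 * n * j))); last first.
  rewrite ltn_exp2l //; apply: (leq_ltn_trans (leq_mul (leqnn (2 * n)) le_jn)).
  by rewrite addn1.
rewrite expnM -[j in _ ^ j]card_ord -prod_nat_const.
by apply: leq_prod => i _; apply: leq_trans (choices_leq i) (ltnW (ltn_expl _ _)).
Qed.

Definition rounds_time (t : nat) : nat :=
  n * (round_time t (2 * n * n + 1) + 2) + 1.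

Lemma runs_rounds :
  runs (While (is_one tL) (round;; put tL None MoveLeft))
    (between_rounds 0 1 n) (between_rounds n (\prod_(i < n) choices H i) 0)
    (rounds_time (size H)).
Proof.
rewrite /rounds_time; set T := round_time _ _.
(* Loop invariant: the current index and the number of remaining rounds add up to n. *)
suff loop m j : j + m = n ->
  runs (While (is_one tL) (round;; put tL None MoveLeft))
    (between_rounds j (\prod_(i < j) choices H i) m)
    (between_rounds n (\prod_(i < n) choices H i) 0) (m * (T + 2) + 1).
  by have := loop n 0 erefl; rewrite big_ord0.
elim: m j => [|m IH] j Ej.
  by rewrite addn0 in Ej; rewrite Ej; apply: runs_whileF.
have lt_jn : j < n by lia.
have := @runs_round j (\prod_(i < j) choices H i) m.+1 _ lt_jn
  (size_product (ltnW lt_jn)).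
have -> : (\prod_(i < j) choices H i) * choices H j = \prod_(i < j.+1) choices H i.
  by rewrite big_ord_recr.
move/(_ (size_product lt_jn)) => r1.
have r2 : runs (round;; put tL None MoveLeft)
    (between_rounds j (\prod_(i < j) choices H i) m.+1)
    (between_rounds j.+1 (\prod_(i < j.+1) choices H i) m) (T + 1).
  by apply: (runs_seq r1); case: m {IH Ej r1} => [|m]; exact: runs_on.
by apply: (runs_while_leq _ r2 (IH j.+1 _)) => //; lia.
Qed.

Definition count_time (t : nat) : nat := rounds_time t + 5 * n + 10.

Lemma runs_count_secrets :
  runs count_secrets (zipper [::] (encode H) :: nseq 9 blank)
    (between_rounds n (\prod_(i < n) choices H i) 0) (count_time (size H)).
Proof.
have E : encode H = nseq n true ++ false :: code H.
  by rewrite /encode -/(code H) cat_rcons.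
have r1 := @runs_copy_ones 0 9 (zipper [::] (encode H) :: nseq 9 blank)
  [::] n (false :: code H) [::] isT isT isT erefl (congr1 _ E) erefl.
have r2 := @runs_shift_left 9
  (zipper (nseq n true) (false :: code H) :: nseq 9 blank) (nseq n true) [::] isT.
have r3 := @runs_rewind 0
  (zipper (nseq n true) (false :: code H) :: rcons (nseq 8 blank) (countdown n))
  (nseq n true) (false :: code H) isT erefl.
rewrite !cats0 in r1; rewrite left_of_ones in r2.
rewrite catrev_nseq -E size_nseq in r3.
apply: runs_leq.
  apply: (runs_seq r1); apply: (runs_seq r2); apply: (runs_seq r3).
  do 2![apply: runs_on_seq => //]; exact: runs_rounds.
by rewrite /count_time; lia.
Qed.
End Rounds.

(** * Output and running time *)

Lemma runs_to_end i s l r : i < size s -> nth blank s i = zipper l r ->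
  runs (to_end i) s (set_nth blank s i (zipper (catrev r l) [::]))
    (2 * size r + 1).
Proof.
elim: r l s => [|a r IH] l s lt_i si.
  rewrite (set_nth_nth lt_i si); apply: runs_whileF.
  by rewrite /nonblank cell_reads si.
set s1 := set_nth blank s i (zipper (a :: l) r).
have := IH (a :: l) s1.
rewrite size_set_nth_lt // nth_set_nth_eq set_nth_same => /(_ lt_i erefl) r2.
apply: (@runs_while_leq 1 _ _ _ _ _ _ _ _ _ r2) => //=; last by lia.
  by rewrite /nonblank cell_reads si.
have := runs_on (fun r => cell r i) MoveRight lt_i.
by rewrite cell_reads si.
Qed.

(** Only the cells to the right of the head of [tI] are tracked, because they become the output; the
    remains of the input to the left stay unspecified. *)
Lemma runs_write_loop I V X J C D la ra R K L acc :
  behead I.2 = map Some acc -> exists I',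
  behead I'.2 = map Some (catrev la acc) /\
  runs
    (While (nonblank tA)
      (on tI (fun r => cell r tA) MoveLeft;; shift tA MoveLeft))
    [:: I; V; X; J; C; D; left_of la ra; R; K; L]
    [:: I'; V; X; J; C; D; left_of [::] (catrev la ra); R; K; L]
    (3 * size la + 1).
Proof.
elim: la ra I acc => [|a la IH] ra I acc EI.
  by exists I; split=> //; apply: runs_whileF; case: ra.
pose I1 : tape := (behead I.1, scons (head None I.1) (map Some (a :: acc))).
have EI1 : behead I1.2 = map Some (a :: acc).
  by rewrite /I1; case: (head _ _).
have [I' [EI' r1]] := IH (a :: ra) I1 _ EI1.
exists I'; split=> //.
apply: (@runs_while_leq 2 _ _ _ _ _ _ _ _ _ r1) => //; last by rewrite /=; lia.
apply: runs_on_seq => //; rewrite /= /norm_act /= EI.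
by case: la {IH r1 EI'} => [|b la]; exact: runs_on.
Qed.

Section Outputs.
Variables (n : nat) (H : history n).

Let count := \prod_(i < n) choices H i.
Let result := between_rounds H n count 0.

Definition total_time (t : nat) : nat :=
  count_time n t + 2 * (n + 1 + t * (2 * n + 1)) + 5 * (2 * n * n + 1) + 10.

Lemma size_encode : size (encode H) <= n + 1 + size H * (2 * n + 1).
Proof.
rewrite /encode size_cat size_rcons size_nseq -/(code H) addn1 leq_add2l.
exact: size_code.
Qed.

Lemma word_before_blank_map s : word_before_blank (map Some s) = s.
Proof. by elim: s => //= b s ->. Qed.

Lemma runs_write_nonzero : exists s, runs (count_secrets;; write_nonzero)
    (zipper [::] (encode H) :: nseq 9 blank) s (total_time (size H)) /\
  word_before_blank (nth blank s 0).2 = [:: count != 0].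
Proof.
have r1 := runs_count_secrets H.
have r2 := @runs_to_end 0 result [::] (encode H) isT erefl.
have r3 := @runs_on 0 (fun r => Some (nonblank tA r)) MoveStay
  (set_nth blank result 0 (zipper (rev (encode H)) [::])) isT.
eexists; split.
  apply: runs_leq; first exact: (runs_seq r1 (runs_seq r2 r3)).
  by have := size_encode; rewrite /total_time; lia.
rewrite nth_set_nth_eq /= -binary_eq0 /nonblank /cell /= /zipper.
by case: (binary count).
Qed.

Lemma runs_write_product : exists s, runs (count_secrets;; write_product)
    (zipper [::] (encode H) :: nseq 9 blank) s (total_time (size H)) /\
  word_before_blank (nth blank s 0).2 = binary count.
Proof.
have r1 := runs_count_secrets H.
have r2 := @runs_to_end 0 result [::] (encode H) isT erefl.
have r3 := @runs_to_end 6
  (set_nth blank result 0 (zipper (rev (encode H)) [::])) [::] (binary count)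
  isT erefl.
have r4 := @runs_shift_left 6
  (set_nth blank result 0 (zipper (rev (encode H)) [::])) (rev (binary count))
  [::] isT.
have [I [EI r5]] := @runs_write_loop (zipper (rev (encode H)) [::]) blank blank
  (zipper [::] (index_word n)) blank blank (rev (binary count)) [::] blank blank
  blank [::] erefl.
rewrite catrevE revK cats0 in EI.
eexists; split.
  apply: runs_leq.
    apply: (runs_seq r1); apply: (runs_seq r2); apply: (runs_seq r3).
    apply: (runs_seq r4); apply: (runs_seq r5); exact: runs_on.
  have := size_encode; have := size_product H (leqnn n).
  by rewrite /total_time size_rev -/count; lia.
by rewrite nth_set_nth_eq /= EI word_before_blank_map.
Qed.
End Outputs.

(** The bound is monotone in both arguments; [polytime] asks for a polynomial in the single quantity
    n + t. *)
Lemma total_time_leq n t : total_time n t <= total_time (n + t) (n + t).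
Proof.
rewrite /total_time /count_time /rounds_time /round_time /pass_time.
by do ?[exact: leq_addr | exact: leq_addl | exact: leqnn | apply: leq_add
       | apply: leq_mul].
Qed.

Definition poly_bounded (f : nat -> nat) : Prop :=
  exists p : {poly nat}, forall N, p.[N]%R = f N.

Lemma polynomial_const c : poly_bounded (fun=> c).
Proof. by exists (c%:P)%R => N; rewrite hornerC. Qed.

Lemma polynomial_id : poly_bounded id.
Proof. by exists 'X%R => N; rewrite hornerX. Qed.

Lemma polynomial_add f g :
  poly_bounded f -> poly_bounded g -> poly_bounded (fun N => f N + g N).
Proof.
by case=> p Ep [q Eq]; exists (p + q)%R => N; rewrite hornerD Ep Eq.
Qed.

Lemma polynomial_mul f g :
  poly_bounded f -> poly_bounded g -> poly_bounded (fun N => f N * g N).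
Proof.
by case=> p Ep [q Eq]; exists (p * q)%R => N; rewrite hornerM Ep Eq.
Qed.

Lemma polynomial_total_time : poly_bounded (fun N => total_time N N).
Proof.
rewrite /total_time /count_time /rounds_time /round_time /pass_time.
by do ?[exact: polynomial_const | exact: polynomial_id | apply: polynomial_add
       | apply: polynomial_mul].
Qed.

Lemma runs_polytime c (F : forall n, history n -> seq bool) :
  (forall n (H : history n), exists s,
     runs c (zipper [::] (encode H) :: nseq 9 blank) s (total_time n (size H)) /\
     word_before_blank (nth blank s 0).2 = F n H) ->
  polytime F.
Proof.
move=> cF; have [p Ep] := polynomial_total_time.
exists (compiled 9 c), p => n H; have [s [r <-]] := cF n H.
by rewrite Ep; apply: runs_halts; apply: runs_leq r (total_time_leq _ _).
Qed.

Theorem theorem2p2 :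
  polytime (fun n (H : history n) => [:: feasible H]) /\
  polytime (fun n (H : history n) =>
    binary #|[set zp : secret n | consistent H zp]|).
Proof.
split; last first.
  apply: (@runs_polytime (count_secrets;; write_product)) => n H.
  by rewrite card_consistent; apply: runs_write_product.
apply: (@runs_polytime (count_secrets;; write_nonzero)) => n H.
have -> : feasible H = (\prod_(i < n) choices H i != 0).
  rewrite -card_consistent -lt0n; apply/existsP/card_gt0P => -[zp];
  by exists zp; rewrite inE in p *.
exact: runs_write_nonzero.
Qed.
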